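(* Let $\Sigma=(X,\mathcal{D},\phi)$ be a forward complete system and let $0$ be an equilibrium of $\Sigma$. Assume that $0$ is iUGS with $\alpha\in\mathcal{K}$ and $\psi\in\mathcal{K}_\infty$, i.e. $\int_0^\infty\alpha(\|\phi(s,x,d)\|_X)\,ds\le\psi(\|x\|_X)$ for all $x\in X$, $d\in\mathcal{D}$. Then for any $\rho\in\mathcal{K}\setminus\mathcal{K}_\infty$ such that $\rho(r)\le\alpha(r)$ for all $r\in\mathbb{R}_+$, the function $$V(x):=\sup_{d\in\mathcal{D}}\int_0^\infty\rho(\|\phi(s,x,d)\|_X)\,ds,\qquad x\in X,$$ is a (possibly non-coercive) Lyapunov function for $\Sigma$, satisfying $$0<V(x)\le\psi(\|x\|_X)\quad\text{for all }x\in X\setminus\{0\},$$ and such that for all $y\in X$, $s>0$, $d\in\mathcal{D}$ $$\liminf_{h\to+0}V(\phi(s-h,y,d))\ge V(\phi(s,y,d))\ge\liminf_{h\to+0}V(\phi(s+h,y,d)),$$ where the right-hand inequality holds for $s=0$ as well.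
   Context: Notation: $\mathbb{R}_+=[0,\infty)$. Comparison functions: $\mathcal{K}$ is the set of continuous strictly increasing $\gamma:\mathbb{R}_+\to\mathbb{R}_+$ with $\gamma(0)=0$; $\mathcal{K}_\infty$ is the set of unbounded $\gamma\in\mathcal{K}$. A forward complete system $\Sigma=(X,\mathcal{D},\phi)$ consists of a normed linear space $(X,\|\cdot\|_X)$; a nonempty set $\mathcal{D}$ of functions $d:\mathbb{R}_+\to D$ (disturbances), where $D$ is a nonempty subset of a normed linear space; and a map $\phi:\mathbb{R}_+\times X\times\mathcal{D}\to X$ (everywhere defined), such that: - shift invariance: for all $d\in\mathcal{D}$, $\tau\ge0$, $d(\cdot+\tau)\in\mathcal{D}$; - concatenation: for all $d_1,d_2\in\mathcal{D}$ and $t>0$ the function equal to $d_1(\tau)$ for $\tau\in[0,t]$ and to $d_2(\tau-t)$ for $\tau>t$ is in $\mathcal{D}$; - identity: $\phi(0,x,d)=x$ for all $(x,d)$; - causality: if $d(s)=\tilde d(s)$ for all $s\in[0,t]$, then $\phi(t,x,d)=\phi(t,x,\tilde d)$; - continuity: for each $(x,d)$ the map $t\mapsto\phi(t,x,d)$ is continuous; - cocycle property: $\phi(h,\phi(t,x,d),d(t+\cdot))=\phi(t+h,x,d)$ for all $t,h\ge0$, $x\in X$, $d\in\mathcal{D}$. $0\in X$ is an equilibrium point if $\phi(t,0,d)=0$ for all $t\ge0$, $d\in\mathcal{D}$. Non-coercive Lyapunov function for $\Sigma$: a map $V:X\to\mathbb{R}_+$ (no continuity assumed) such that (a) for all $y\in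 X$, $s>0$, $d\in\mathcal{D}$: $\liminf_{h\to+0}V(\phi(s-h,y,d))\ge V(\phi(s,y,d))\ge\liminf_{h\to+0}V(\phi(s+h,y,d))$, and the right-hand inequality also holds for $s=0$; (b) $V(0)=0$ and there is $\psi_2\in\mathcal{K}_\infty$ with $0<V(x)\le\psi_2(\|x\|_X)$ for all $x\in X\setminus\{0\}$; (c) there is a function $\tilde\alpha\in\mathcal{K}$ such that $\dot V_d(x)\le-\tilde\alpha(\|x\|_X)$ for all $x\in X$, $d\in\mathcal{D}$, where $\dot V_d(x):=\liminf_{t\to+0}\frac1t\big(V(\phi(t,x,d))-V(x)\big)$. ''Possibly non-coercive'' means that no lower bound of the form $\psi_1(\|x\|_X)\le V(x)$ with $\psi_1\in\mathcal{K}_\infty$ is claimed.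
   Formalization: Concatenation is taken as d_1 on [0,t) and d_2(τ−t) for τ≥t (instead of d_1 on [0,t] and d_2(τ−t) for τ>t), because with the original endpoint φ may depend on the single value d(0) and the left liminf inequality can fail. *)

(* Defs.v *)
From HB Require Import structures.
From mathcomp Require Import all_boot all_order all_algebra.
From mathcomp Require Import all_classical all_reals all_analysis.

Set Implicit Arguments.
Unset Strict Implicit.
Unset Printing Implicit Defensive.

Import Order.TTheory GRing.Theory Num.Theory.
Import numFieldNormedType.Exports.

Local Open Scope classical_set_scope.
Local Open Scope ring_scope.

(* Functions on R_+ are represented by functions R -> R of which only the values
   on [0, +oo[ are used. *)
Definition classK (R : realType) (g : R -> R) : Prop :=
  [/\ {within `[0, +oo[, continuous g},
      {in `[0, +oo[ &, {homo g : r s / r < s}} & g 0 = 0].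

Definition classKinf (R : realType) (g : R -> R) : Prop :=
  classK g /\ (forall M : R, exists2 r : R, 0 <= r & M < g r).

Lemma max0_ge0 (R : realType) (t : R) : 0 <= Num.max 0 t.
Proof. by rewrite le_max lexx. Qed.

Definition time (R : realType) (t : R) : {nonneg R} := NngNum (max0_ge0 t).

Definition shift (R : realType) (W : Type) (t : {nonneg R})
    (d : {nonneg R} -> W) : {nonneg R} -> W :=
  fun s => d (t%:num + s%:num)%:nng.

(* d1 on [0, t[, then d2 restarted at time t. The value at the junction is d2 0,
   so that shift t (concat t d1 d2) is exactly d2. With the value d1 t instead,
   the shifted function could differ from d2 at 0; as causality may depend on
   the single value of the disturbance at 0, the axioms below would then not
   allow following d1 up to time t and d2 from there on. *)
Definition concat (R : realType) (W : Type) (t : {nonneg R})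
    (d1 d2 : {nonneg R} -> W) : {nonneg R} -> W :=
  fun s => if s%:num < t%:num then d1 s else d2 (time (s%:num - t%:num)).

(* W is the normed space containing the set D of disturbance values. The map
   phi is total, but it is only constrained, and below only used, on
   disturbances in dist. *)
Record fc_system (R : realType) (X W : normedModType R) := FCSystem {
  dval : set W ;
  dval_neq0 : dval !=set0 ;
  dist : set ({nonneg R} -> W) ;
  dist_neq0 : dist !=set0 ;
  dist_val : forall d, dist d -> forall t, dval (d t) ;
  phi : {nonneg R} -> X -> ({nonneg R} -> W) -> X ;
  dist_shift : forall d t, dist d -> dist (shift t d) ;
  dist_concat : forall d1 d2 (t : {nonneg R}), 0 < t%:num ->
    dist d1 -> dist d2 -> dist (concat t d1 d2) ;
  phi_id : forall x d, dist d -> phi 0%:nng x d = x ;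
  phi_causal : forall t x d d', dist d -> dist d' ->
    (forall s : {nonneg R}, s%:num <= t%:num -> d s = d' s) ->
    phi t x d = phi t x d' ;
  phi_continuous : forall x d, dist d ->
    {within `[0, +oo[, continuous (fun t : R => phi (time t) x d)} ;
  phi_cocycle : forall (t h : {nonneg R}) x d, dist d ->
    phi h (phi t x d) (shift t d) = phi (t%:num + h%:num)%:nng x d
}.

Section Stability.
Variables (R : realType) (X W : normedModType R) (S : fc_system X W).

Definition equilibrium0 : Prop := forall t d, dist S d -> phi S t 0 d = 0.

Definition path_integral (g : R -> R) (x : X) (d : {nonneg R} -> W) : \bar R :=
  (\int[lebesgue_measure]_(s in `[0%R, +oo[) (g `|phi S (time s) x d|)%:E)%E.

Definition iUGS (alpha psi : R -> R) : Prop :=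
  forall x d, dist S d -> (path_integral alpha x d <= (psi `|x|)%:E)%E.

Definition orbit_monotone (V : X -> R) : Prop :=
  forall (y : X) (d : {nonneg R} -> W), dist S d ->
    (forall s : R, 0 < s ->
      (limf_einf (fun h : R => (V (phi S (time (s - h)) y d))%:E) 0^'+
         >= (V (phi S (time s) y d))%:E)%E) /\
    (forall s : R, 0 <= s ->
      ((V (phi S (time s) y d))%:E
         >= limf_einf (fun h : R => (V (phi S (time (s + h)) y d))%:E) 0^'+)%E).

Definition dini (V : X -> R) (d : {nonneg R} -> W) (x : X) : \bar R :=
  limf_einf (fun t : R => (t^-1 * (V (phi S (time t) x d) - V x))%:E) 0^'+.

Definition noncoercive_Lyapunov (V : X -> R) : Prop :=
  [/\ forall x, 0 <= V x,
      orbit_monotone V,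
      V 0 = 0 /\ (exists2 psi2 : R -> R, classKinf psi2 &
        forall x, x != 0 -> 0 < V x <= psi2 `|x|) &
      exists2 alpha : R -> R, classK alpha &
        forall x d, dist S d -> (dini V d x <= (- alpha `|x|)%:E)%E].

Definition sup_path_integral (g : R -> R) (x : X) : \bar R :=
  ereal_sup [set path_integral g x d | d in dist S].

End Stability.

(* Main.v *)
(* The dynamic programming inequality
     V(x) >= int_0^t rho(|phi(s,x,d)|) ds + V(phi(t,x,d))
   follows by concatenating d on [0, t[ with an arbitrary disturbance. Hence V is
   nonincreasing along trajectories, which gives both liminf inequalities, and
   continuity of s |-> rho(|phi(s,x,d)|) at 0 gives the decay rate rho(|x|) of the
   Dini derivative and the positivity of V outside 0. *)
Require Import Defs.
From mathcomp Require Import all_boot all_order all_algebra.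
From mathcomp Require Import all_classical all_reals all_analysis.
From mathcomp Require Import measurable_realfun.
From mathcomp Require Import lra.
Import Order.TTheory GRing.Theory Num.Theory.
Import numFieldNormedType.Exports.
Local Open Scope classical_set_scope.
Local Open Scope ring_scope.

(** * Comparison functions, lower limits and translation of integrals *)

Lemma classK_ge0 (R : realType) (g : R -> R) (r : R) :
  classK g -> 0 <= r -> 0 <= g r.
Proof.
move=> [_ gi g0]; rewrite le_eqVlt => /predU1P[<-|r0]; first by rewrite g0.
by rewrite -g0 ltW// gi// in_itv/= andbT// ltW.
Qed.

Lemma classK_gt0 (R : realType) (g : R -> R) (r : R) :
  classK g -> 0 < r -> 0 < g r.
Proof.
by move=> [_ gi g0] r0; rewrite -{1}g0 gi// in_itv/= andbT// ltW.
Qed.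

Lemma timeE (R : realType) (t : {nonneg R}) : time t%:num = t.
Proof. by apply: val_inj => /=; apply/max_idPr. Qed.

Lemma timeK (R : realType) (t : R) : 0 <= t -> (time t)%:num = t.
Proof. by move=> t0 /=; apply/max_idPr. Qed.

(** In a proper filter every member meets the set where [f] is at most [l], so each infimum entering
    the lower limit is at most [l]. *)
Lemma limf_einf_le (R : realType) (f : R -> \bar R) (F : set_system R)
    (l : \bar R) : ProperFilter F ->
  (\forall h \near F, (f h <= l)%E) -> (limf_einf f F <= l)%E.
Proof.
move=> FF fl; rewrite limf_einfE; apply: ge_ereal_sup => _ [A FA <-].
have /filter_ex[h [Ah fhl]] : F (A `&` [set h | (f h <= l)%E]) by exact: filterI.
by apply: le_trans fhl; apply: ereal_inf_lbound; exists h.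
Qed.

Lemma limf_einf_ge (R : realType) (f : R -> \bar R) (F : set_system R)
    (l : \bar R) :
  (\forall h \near F, (l <= f h)%E) -> (l <= limf_einf f F)%E.
Proof.
move=> fl; rewrite limf_einfE; apply: le_ereal_sup_tmp.
exists (ereal_inf (f @` [set h | (l <= f h)%E])).
  by exists [set h | (l <= f h)%E].
by apply: le_ereal_inf_tmp => _ [h lfh <-].
Qed.

Lemma ge0_integral_shift (R : realType) (g : R -> R) (t : R) :
  {within `[t, +oo[, continuous g} -> {in `]t, +oo[, forall s, 0 <= g s} ->
  (\int[lebesgue_measure]_(s in `[t, +oo[) (g s)%:E =
   \int[lebesgue_measure]_(s in `[0%R, +oo[) (g (t + s)%R)%:E)%E.
Proof.
move=> cg g0.
have d1 : (fun s : R => t + s)^`()%classic = cst 1.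
  apply/funext => s; rewrite derive1E deriveD// derive_cst add0r.
  by rewrite derive_id.
have ct (s : R) : {for s, continuous (fun s : R => t + s)}.
  by apply: cvgD; [exact: cvg_cst|exact: cvg_id].
(* The lower endpoint is written as the image of 0 under the translation, the form expected by the
   substitution rule. *)
rewrite -{1}[t]addr0.
rewrite (@increasing_ge0_integration_by_substitutiony R (fun s => t + s) g 0).
- by apply: eq_integral => s _; rewrite d1 /= mulr1.
- by move=> x y _ _; rewrite ltrD2l.
- by move=> s _; rewrite d1; exact: cvg_cst.
- by rewrite d1; apply: is_cvg_cst.
- by rewrite d1; apply: is_cvg_cst.
- split=> //; exact: cvg_at_right_filter (ct 0).
- by apply: cvg_addrl.
- by rewrite addr0.
- by rewrite addr0.
Qed.

(** * Regularity of the running cost along a trajectory *)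

Section Paths.
Variables (R : realType) (X W : normedModType R) (S : fc_system X W).

Lemma path_running_cost_continuous (g : R -> R) (x : X) (d : {nonneg R} -> W) :
  classK g -> dist S d ->
  {within `[0, +oo[, continuous (fun s : R => g `|phi S (time s) x d|)}.
Proof.
move=> [cg _ _] dd; apply/subspace_continuousP => s s0.
have cn := (subspace_continuousP _ _).1 (@phi_continuous R X W S x d dd) s s0.
have gn := (subspace_continuousP _ _).1 cg `|phi S (time s) x d|.
apply: cvg_trans (gn _); last by rewrite /= in_itv/= normr_ge0.
move=> B /= gB.
(* Norms are nonnegative, so the path of norms stays in the half-line where [g] is continuous, and
   neighbourhoods within it pull back along the trajectory. *)
have /cvg_norm := cn.
move=> /(_ _ gB)[e e0 He]; exists e => // u ue u0.
by apply: (He u ue u0); rewrite /= in_itv/= normr_ge0.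
Qed.

Lemma path_running_cost_measurable (g : R -> R) (x : X) (d : {nonneg R} -> W) :
  classK g -> dist S d ->
  measurable_fun `[(0 : R), +oo[ (fun s : R => g `|phi S (time s) x d|).
Proof.
move=> Kg dd; apply: subspace_continuous_measurable_fun => //.
exact: path_running_cost_continuous.
Qed.

Lemma path_integral_ge0 (g : R -> R) (x : X) (d : {nonneg R} -> W) :
  classK g -> (0 <= path_integral S g x d)%E.
Proof.
by move=> Kg; apply: integral_ge0 => s _; rewrite lee_fin classK_ge0.
Qed.

(** * Concatenated disturbances and dynamic programming *)

Lemma phi_concat_before (t s : R) (x : X) (d1 d2 : {nonneg R} -> W) :
  0 < t -> 0 <= s < t -> dist S d1 -> dist S d2 ->
  phi S (time s) x (concat (time t) d1 d2) = phi S (time s) x d1.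
Proof.
move=> t0 /andP[s0 st] dd1 dd2; apply: phi_causal => //.
  by apply: dist_concat => //; rewrite timeK// ltW.
move=> u; rewrite timeK// => us; rewrite /concat timeK ?ltW//.
by rewrite ifT// (le_lt_trans us).
Qed.

(* The two disturbances may differ at [t] itself, so causality only gives
   equality before [t]; continuity of the trajectories extends it to [t]. *)
Lemma phi_concat_at (t : R) (x : X) (d1 d2 : {nonneg R} -> W) :
  0 < t -> dist S d1 -> dist S d2 ->
  phi S (time t) x (concat (time t) d1 d2) = phi S (time t) x d1.
Proof.
move=> t0 dd1 dd2.
have dc : dist S (concat (time t) d1 d2).
  by apply: dist_concat => //; rewrite timeK// ltW.
have cvt d : dist S d ->
    phi S (time s) x d @[s --> t^'-] --> phi S (time t) x d.
  move=> dd; apply: cvg_at_left_filter.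
  have /continuous_within_itvcyP[+ _] := @phi_continuous R X W S x d dd.
  by apply; rewrite in_itv/= t0.
apply: (@cvg_unique _ _ (phi S (time s) x d1 @[s --> t^'-])).
- exact: norm_hausdorff.
- apply: cvg_trans (cvt _ dc); apply: near_eq_cvg.
  near=> s; apply: phi_concat_before => //; apply/andP; split; last by [].
  by near: s; exact: nbhs_left_ge.
- exact: cvt.
Unshelve. all: by end_near. Qed.

(** Shifting the concatenation by [t] gives back exactly [d2], including its value at 0, so the
    cocycle property restarts the trajectory at the state reached under [d1]. *)
Lemma phi_concat_after (t s : R) (x : X) (d1 d2 : {nonneg R} -> W) :
  0 < t -> 0 <= s -> dist S d1 -> dist S d2 ->
  phi S (time (t + s)) x (concat (time t) d1 d2) =
  phi S (time s) (phi S (time t) x d1) d2.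
Proof.
move=> t0 s0 dd1 dd2.
have dc : dist S (concat (time t) d1 d2).
  by apply: dist_concat => //; rewrite timeK// ltW.
rewrite -(phi_concat_at t x d1 d2)//.
have {3}-> : d2 = Defs.shift (time t) (concat (time t) d1 d2).
  apply/funext => u; rewrite /Defs.shift /concat /= ltNge lerDl ge0/=.
  by rewrite addrAC subrr add0r timeE.
rewrite phi_cocycle//; congr (phi S _ x _); apply: val_inj => /=.
by rewrite !(max_idPr _)//; [exact: ltW|rewrite addr_ge0// ltW].
Qed.

Lemma sup_path_integral_dynprog (g : R -> R) (t : R) (x : X)
    (d : {nonneg R} -> W) :
  classK g -> 0 < t -> dist S d ->
  (\int[lebesgue_measure]_(s in `[0%R, t[) (g `|phi S (time s) x d|)%:E
   + sup_path_integral S g (phi S (time t) x d) <= sup_path_integral S g x)%E.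
Proof.
move=> Kg t0 dd.
rewrite addeC.
set I := (\int[_]_(_ in _) _)%E.
have I0 : (0 <= I)%E by apply: integral_ge0 => s _; rewrite lee_fin classK_ge0.
suff key d2 : dist S d2 ->
    (path_integral S g (phi S (time t) x d) d2 + I <= sup_path_integral S g x)%E.
  (* Passing to the supremum over [d2] means moving [I] to the other side, which needs [I] finite.
     If [I] is infinite, [key] for a single [d2] already makes the right-hand side infinite. *)
  have [Iy|Ify] := eqVneq I +oo%E.
    have [d2 dd2] := dist_neq0 S.
    have := key _ dd2; rewrite {1}Iy addey; last first.
      rewrite -ltNye; apply: lt_le_trans (path_integral_ge0 g _ d2 Kg).
      by rewrite ltNy0.
    by rewrite leye_eq => /eqP ->; rewrite leey.
  have If : I \is a fin_num by rewrite ge0_fin_numE// ltey.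
  rewrite -leeBrDr//; apply: ge_ereal_sup => _ [d2 dd2 <-].
  by rewrite leeBrDr// key.
move=> dd2.
have dc : dist S (concat (time t) d d2).
  by apply: dist_concat => //; rewrite timeK// ltW.
apply: (@le_trans _ _ (path_integral S g x (concat (time t) d d2))); last first.
  by apply: ereal_sup_ubound; exists (concat (time t) d d2).
(* The cost of the concatenated disturbance is split at the switching time: the first piece is [I],
   and the second, translated back to 0, is the cost of [d2] from the state at time [t]. *)
have U : `[0, +oo[%classic = `[0, t[%classic `|` `[t, +oo[%classic :> set R.
  by rewrite -(@itv_bndbnd_setU _ _ _ (BLeft t))// bnd_simp ltW.
rewrite {2}/path_integral U ge0_integral_setU//=.
- rewrite addeC; apply: leeD.
    rewrite /I le_eqVlt; apply/orP; left; apply/eqP.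
    apply: eq_integral => s; rewrite inE/= in_itv/= => st.
    by rewrite phi_concat_before.
  rewrite ge0_integral_shift.
  + rewrite /path_integral le_eqVlt; apply/orP; left; apply/eqP.
    apply: eq_integral => s; rewrite inE/= in_itv/= andbT => s0.
    by rewrite phi_concat_after.
  + apply: continuous_subspaceW (path_running_cost_continuous g x _ Kg dc).
    by rewrite U; exact: subsetUr.
  + by move=> s _; rewrite classK_ge0.
- by rewrite -U; apply/measurable_EFinP; exact: path_running_cost_measurable.
- by move=> s _; rewrite lee_fin classK_ge0.
- apply/disj_setPS => s [] /=; rewrite !in_itv/= andbT => /andP[_ st] ts.
  by move: (lt_le_trans st ts); rewrite ltxx.
Qed.

(** * Bounds, monotonicity and decay of the value function *)

Lemma sup_path_integral_ge0 (g : R -> R) (x : X) :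
  classK g -> (0 <= sup_path_integral S g x)%E.
Proof.
move=> Kg; have [d dd] := dist_neq0 S.
apply: le_trans (path_integral_ge0 g x d Kg) _.
by apply: ereal_sup_ubound; exists d.
Qed.

(** The running cost starts at [g |x|] and is continuous, so it stays above [c] on a short initial
    interval; integrating the constant [c] gives the bound. *)
Lemma path_integral_initial_bound (g : R -> R) (x : X) (d : {nonneg R} -> W)
    (c : R) : classK g -> dist S d -> c < g `|x| ->
  \forall t \near 0^'+, ((c * t)%:E <=
    \int[lebesgue_measure]_(s in `[0%R, t[) (g `|phi S (time s) x d|)%:E)%E.
Proof.
move=> Kg dd cx.
have mI (t : R) : measurable_fun `[(0 : R), t[
    (fun s : R => g `|phi S (time s) x d|).
  apply: (@measurable_funS _ _ _ _ `[(0 : R), +oo[) => //; last first.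
    exact: path_running_cost_measurable.
  by move=> s; rewrite /= !in_itv/= => /andP[->].
have f0 : g `|phi S (time 0) x d| = g `|x|.
  have -> : time 0 = 0%:nng :> {nonneg R} by apply: val_inj; rewrite /= maxxx.
  by rewrite phi_id.
(* Comparing integrals of nonnegative functions requires [c] nonnegative; for negative [c] the
   left-hand side is at most 0. *)
have [c0|c0] := ltP c 0.
  near=> t; apply: (@le_trans _ _ 0%E).
    by rewrite lee_fin mulr_le0_ge0// ltW.
  by apply: integral_ge0 => s _; rewrite lee_fin classK_ge0.
have /subspace_continuousP := path_running_cost_continuous g x d Kg dd.
move=> /(_ 0); rewrite [from_subspace _ _ _]f0 /= in_itv/= lexx.
move=> /(_ isT) /cvgr_gt /(_ _ cx).
move=> [e /= e0 He]; near=> t.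
have -> : ((c * t)%:E =
    \int[lebesgue_measure]_(s in `[0%R, t[) (cst c%:E s))%E.
  by rewrite integral_cst//= lebesgue_measure_itv/= lte_fin ifT// sube0.
apply: ge0_le_integral => //.
- by apply/measurable_EFinP; exact: mI.
- move=> s; rewrite /= in_itv/= => /andP[s0 st].
  rewrite lee_fin ltW//; apply: He; rewrite /= ?in_itv/= ?s0//.
  by rewrite sub0r normrN ger0_norm// (lt_trans st).
Unshelve. all: by end_near. Qed.

Lemma sup_path_integral_gt0 (g : R -> R) (x : X) :
  classK g -> x != 0 -> (0 < sup_path_integral S g x)%E.
Proof.
move=> Kg x0; have [d dd] := dist_neq0 S.
have gx : 0 < g `|x| by rewrite classK_gt0// normr_gt0.
(* Any constant strictly between 0 and [g |x|] would do: the cost over a short interval is then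
   positive, and dynamic programming carries this to the supremum. *)
have cx : g `|x| / 2 < g `|x| by rewrite ltr_pdivrMr// ltr_pMr// ltr1n.
have bd := path_integral_initial_bound g x d _ Kg dd cx.
have [t [t0 tI]] : exists t, 0 < t /\ ((g `|x| / 2 * t)%:E <=
    \int[lebesgue_measure]_(s in `[0%R, t[) (g `|phi S (time s) x d|)%:E)%E.
  apply: (@filter_ex _ (0 : R)^'+); near=> t; split; first by [].
  by near: t.
apply: (@lt_le_trans _ _ (g `|x| / 2 * t)%:E).
  by rewrite lte_fin mulr_gt0// divr_gt0.
apply: le_trans (sup_path_integral_dynprog g t x d Kg t0 dd).
by apply: le_trans tI _; rewrite leeDl// sup_path_integral_ge0.
Unshelve. all: by end_near. Qed.

Lemma sup_path_integral_nonincreasing (g : R -> R) (s u : R) (x : X)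
    (d : {nonneg R} -> W) : classK g -> dist S d -> 0 <= s <= u ->
  (sup_path_integral S g (phi S (time u) x d) <=
   sup_path_integral S g (phi S (time s) x d))%E.
Proof.
move=> Kg dd /andP[s0]; rewrite le_eqVlt => /predU1P[<-//|su].
have us0 : 0 < u - s by rewrite subr_gt0.
(* The state at time [u] is reached from the state at time [s] in the positive time [u - s], so
   dynamic programming applies there; dropping the nonnegative integral gives monotonicity. *)
have -> : phi S (time u) x d =
    phi S (time (u - s)) (phi S (time s) x d) (Defs.shift (time s) d).
  rewrite phi_cocycle//; congr (phi S _ x d); apply: val_inj => /=.
  by rewrite !(max_idPr _) ?subrKC// ltW// (le_lt_trans s0).
have ds : dist S (Defs.shift (time s) d) by exact: dist_shift.
apply: le_trans (sup_path_integral_dynprog g (u - s) _ _ Kg us0 ds).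
rewrite leeDr//; apply: integral_ge0 => r _.
by rewrite lee_fin classK_ge0.
Qed.

(** This is where integral stability enters: it makes the supremum finite, hence a real-valued
    function. *)
Lemma sup_path_integral_le (alpha psi g : R -> R) (x : X) :
  classK alpha -> classK g -> iUGS S alpha psi ->
  (forall r, 0 <= r -> g r <= alpha r) ->
  (sup_path_integral S g x <= (psi `|x|)%:E)%E.
Proof.
move=> Ka Kg ia ga; apply: ge_ereal_sup => _ [d dd <-].
apply: le_trans (ia x d dd); apply: ge0_le_integral => //.
- by move=> s _; rewrite lee_fin classK_ge0.
- by apply/measurable_EFinP; exact: path_running_cost_measurable.
- by apply/measurable_EFinP; exact: path_running_cost_measurable.
- by move=> s _; rewrite lee_fin ga.
Qed.

(** For small [t] the initial cost is at least [(g |x| - e) * t], so by dynamic programming the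
    difference quotient is at most [- g |x| + e], with [e] an arbitrary positive slack. *)
Lemma dini_sup_path_integral (g : R -> R) (x : X) (d : {nonneg R} -> W) :
  classK g -> dist S d -> (forall y, sup_path_integral S g y \is a fin_num) ->
  (dini S (fun y => fine (sup_path_integral S g y)) d x <= (- g `|x|)%:E)%E.
Proof.
move=> Kg dd Vfin; apply/lee_addgt0Pr => e e0.
apply: limf_einf_le.
have cx : g `|x| - e < g `|x| by rewrite ltrBlDr ltrDl.
near=> t.
have t0 : 0 < t by [].
have It : (((g `|x| - e) * t)%:E <=
    \int[lebesgue_measure]_(s in `[0%R, t[) (g `|phi S (time s) x d|)%:E)%E.
  by near: t; exact: path_integral_initial_bound.
have := sup_path_integral_dynprog g t x d Kg t0 dd.
move=> /(le_trans (leeD2r _ It)).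
(* Finiteness of both values turns the extended inequality into a real one that can be divided by
   [t]. *)
rewrite -(fineK (Vfin (phi _ _ _ _))) -(fineK (Vfin x)) -!EFinD !lee_fin => H.
by rewrite ler_pdivrMl//; lra.
Unshelve. all: by end_near. Qed.

End Paths.

Theorem theorem4 (R : realType) (X W : normedModType R) (S : fc_system X W)
    (alpha psi : R -> R) :
  equilibrium0 S -> classK alpha -> classKinf psi -> iUGS S alpha psi ->
  forall rho : R -> R, classK rho -> ~ classKinf rho ->
    (forall r : R, 0 <= r -> rho r <= alpha r) ->
  (forall x : X, sup_path_integral S rho x \is a fin_num) /\
  (let V := fun x : X => fine (sup_path_integral S rho x) in
   [/\ noncoercive_Lyapunov S V,
       forall x : X, x != 0 -> 0 < V x <= psi `|x| &
       forall (y : X) (d : {nonneg R} -> W), dist S d ->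
         (forall s : R, 0 < s ->
           (limf_einf (fun h : R => (V (phi S (time (s - h)) y d))%:E) 0^'+
              >= (V (phi S (time s) y d))%:E)%E) /\
         (forall s : R, 0 <= s ->
           ((V (phi S (time s) y d))%:E
              >= limf_einf (fun h : R => (V (phi S (time (s + h)) y d))%:E)
                   0^'+)%E)]).
Proof.
move=> _ Ka Kpsi ia rho Krho _ rhoa.
have Vle x : (sup_path_integral S rho x <= (psi `|x|)%:E)%E.
  exact: sup_path_integral_le Ka Krho ia rhoa.
have Vge0 x : (0 <= sup_path_integral S rho x)%E.
  exact: sup_path_integral_ge0.
have Vfin x : sup_path_integral S rho x \is a fin_num.
  by rewrite ge0_fin_numE// (le_lt_trans (Vle x)) ?ltry.
split=> // V.
have VE x : (V x)%:E = sup_path_integral S rho x by rewrite fineK.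
have Vmono : orbit_monotone S V.
  move=> y d dd; split=> s s0.
    apply: limf_einf_ge; near=> h.
    have h0 : 0 < h by [].
    (* This keeps [s - h] nonnegative, so that [time] does not truncate it to 0. *)
    have hs : h <= s by near: h; exact: nbhs_right_le.
    rewrite !VE; apply: sup_path_integral_nonincreasing => //.
    by rewrite subr_ge0 hs gerBl ltW.
  apply: limf_einf_le; near=> h.
  have h0 : 0 < h by [].
  rewrite !VE; apply: sup_path_integral_nonincreasing => //.
  by rewrite s0 lerDl ltW.
have Vbound x : x != 0 -> 0 < V x <= psi `|x|.
  by move=> x0; rewrite -lte_fin -lee_fin !VE Vle sup_path_integral_gt0.
split=> //; split=> //.
- by move=> x; rewrite -lee_fin VE.
- split; last by exists psi.
  (* At the origin the upper bound is [psi 0 = 0], which together with nonnegativity forces the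
     value 0. *)
  have [[_ _ psi0] _] := Kpsi.
  apply/eqP; rewrite eq_le -!lee_fin !VE Vge0 andbT.
  by rewrite -psi0 -[in psi 0](@normr0 R X).
(* The decay rate is [rho] itself. *)
- by exists rho => // x d dd; exact: dini_sup_path_integral.
Unshelve. all: by end_near. Qed.
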